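(* Let $q=p^e$ be a prime power ($p$ prime, $e\ge1$), and for integers $n\ge0$, $k\ge1$ let $a_{n,k}$ be the number of $n\times n$ matrices $B$ over $\mathbb{F}_q$ with $B^k=0$. Then $$v_q(a_{n,k})\geq \frac{k-1}{k+1}\binom{n}{2},$$ and equality holds whenever $n\equiv 0$ or $1\pmod{k+1}$.
   Context: For a nonzero integer $a$, $v_q(a)=v_p(a)/e$, where $v_p$ is the $p$-adic valuation and $q=p^e$. *)

(* Defs.v *)
From HB Require Import structures.
From mathcomp Require Import all_boot all_order all_algebra.
Set Implicit Arguments.
Unset Strict Implicit.
Unset Printing Implicit Defensive.
Import GRing.Theory.
Local Open Scope ring_scope.

(* v_q(a) = v_p(a) / e for q = p ^ e and a a nonzero integer. It is only
   meaningful for a != 0: logn p 0 = 0 is a junk value. *)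
Definition vq (p e : nat) (a : int) : rat := (logn p `|a|%N)%:R / e%:R.

Definition num_nilp (F : finFieldType) (n k : nat) : nat :=
  #|[set B : 'M[F]_n | B ^+ k == 0]|.

(* Main.v *)
(** Let [c n i] count the pairs [(B, v)] with [B ^ k = 0] and [v B ^ i = 0], so
    that [c n 0] is the number of solutions of [B ^ k = 0] and
    [c n k = q ^ n * c n 0].  If [v B ^ j != 0 = v B ^ (j + 1)] then
    [v, v B, ..., v B ^ j] are linearly independent, [B] is block triangular in
    a basis extending them, and counting the possible lower left blocks gives,
    with [N] the number of [(j + 1) x n] matrices of full row rank,
      [c n (j + 1) = c n j + N * q ^ ((n - j - 1) * j) * c (n - j - 1) (k - j - 1)].
    By induction on [n] this recursion yields
      [v_q (c n i) >= ((k - 1) * 'C(n, 2) + i * n) / (k + 1)] for [i < k],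
    where [c n 0] is controlled through
      [(q ^ n - 1) * c n 0 = c n k - c n 0].
    Using the step [j = 0] and then the step [j = k - 1] relates [c n 0] to
    [c (n - k - 1) 0] modulo terms of strictly larger valuation, so equality
    propagates from [n = 0, 1] to [n = 0, 1] modulo [k + 1]. *)

Require Import Defs.
From mathcomp Require Import all_boot all_order all_algebra.
From mathcomp Require Import mxabelem zify.
Import Order.TTheory GRing.Theory Num.Theory.
Local Open Scope ring_scope.

(** * Counting by bijections and by fibres *)

Lemma card_set_bij (T U : finType) (P : pred T) (Q : pred U)
    (f : T -> U) (g : U -> T) :
    (forall x, P x -> Q (f x) /\ g (f x) = x) ->
    (forall y, Q y -> P (g y) /\ f (g y) = y) ->
  #|[set x | P x]| = #|[set y | Q y]|.
Proof.
move=> fP gQ; rewrite cardsE -(@card_in_imset _ _ f P).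
  apply: eq_card => y; rewrite !inE; apply/imsetP/idP => [[x Px ->]|Qy].
    by have [] := fP x Px.
  by exists (g y); have [] := gQ y Qy.
by apply: (can_in_inj (g := g)) => x Px; have [] := fP x Px.
Qed.

Lemma card_set_pair (T U : finType) (R : T -> U -> bool) :
  #|[set x : T * U | R x.1 x.2]| = (\sum_u #|[set t | R t u]|)%N.
Proof.
under eq_bigr do rewrite -sum1dep_card.
rewrite -sum1dep_card (exchange_big_dep predT) //= pair_big_dep /=.
by apply: eq_bigl => -[].
Qed.

(** * Pairs of a solution of [B ^+ k = 0] and an annihilated row vector *)

Section Counting.

Variable F : finFieldType.

Definition annih_count (k n i : nat) : nat :=
  #|[set x : 'M[F]_n * 'rV[F]_n | (x.1 ^+ k == 0) && (x.2 *m x.1 ^+ i == 0)]|.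

Definition free_count (i n : nat) : nat := #|[set P : 'M[F]_(i, n) | row_free P]|.

Lemma annih_count0 k n : annih_count k n 0 = num_nilp F n k.
Proof.
apply: (card_set_bij _ _ _ _ fst (fun B => (B, 0))) => [[B v]|B] /=.
  by rewrite expr0 mulmx1 => /andP[-> /eqP->].
by move=> ->; rewrite mul0mx eqxx.
Qed.

Lemma annih_count_full k n : annih_count k n k = (num_nilp F n k * #|F| ^ n)%N.
Proof.
rewrite /num_nilp -[n in (_ ^ n)%N]mul1n -card_mx -cardsT -cardsX.
apply: eq_card => -[B v]; rewrite !inE /= andbT.
by apply: andb_idr => /eqP->; rewrite mulmx0.
Qed.

(** * Matrices of full row rank *)

Lemma free_count0 n : free_count 0 n = 1%N.
Proof.
rewrite /free_count (_ : [set _ | _] = setT) ?cardsT ?card_mx ?mul0n //.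
by apply/setP => P; rewrite !inE -row_leq_rank.
Qed.

Lemma row_free_col_mx i n (v : 'rV[F]_n) (P : 'M[F]_(i, n)) :
  row_free (col_mx v P : 'M_(1 + i, n)) = row_free P && ~~ (v <= P)%MS.
Proof.
rewrite -!row_leq_rank -addsmxE; have [vP|vP] /= := boolP (v <= P)%MS.
  by rewrite (addsmx_idPr vP) andbF leqNgt ltnS rank_leq_row.
have v0 : v != 0 by apply: contraNneq vP => ->; exact: sub0mx.
have := mxrank_sum_cap v P; rewrite rank_rV v0 (_ : \rank (v :&: P) = 0)%N.
  by rewrite addn0 => ->; rewrite andbT leq_add2l.
have := mxrank_leqif_sup (capmxSl v P); rewrite rank_rV v0 sub_capmx submx_refl /=.
rewrite (negbTE vP) => -[le1 /negbT]; rewrite eqn_leq le1 /= -ltnNge ltnS.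
by rewrite leqn0 => /eqP.
Qed.

(** Stacking a row [v] on a free [P] keeps it free exactly when [v] lies outside the row space of
    [P], which has [#|F| ^ i] elements. *)
Lemma free_countS i n :
  free_count i.+1 n = (free_count i n * (#|F| ^ n - #|F| ^ i))%N.
Proof.
transitivity #|[set x : 'rV[F]_n * 'M[F]_(i, n) |
                 row_free x.2 && ~~ (x.1 <= x.2)%MS]|.
  apply: (card_set_bij _ _ _ _
     (fun P : 'M_(1 + i, n) => (usubmx P, dsubmx P))
     (fun x => col_mx x.1 x.2)) => [P|[v P]] /=.
    by rewrite -row_free_col_mx vsubmxK.
  by rewrite -row_free_col_mx col_mxKu col_mxKd.
rewrite (card_set_pair _ _ (fun v P => row_free P && ~~ (v <= P)%MS)).
rewrite (bigID (fun P => row_free P)) /= [X in (_ + X)%N]big1 ?addn0; last first.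
  move=> P /negbTE->; apply/eqP; rewrite cards_eq0.
  by apply/eqP/setP => v; rewrite !inE.
rewrite /free_count -sum1dep_card big_distrl /=; apply: eq_bigr => P fP.
rewrite mul1n fP -[n in RHS]mul1n -card_mx -{2}(eqP fP) -card_rowg.
rewrite -cardsT -cardsDS ?subsetT //.
by apply: eq_card => v; rewrite !inE andbT.
Qed.

(* Multiplication by [t] on the basis 1, t, ..., t^j of F[t]/(t^(j+1)). *)
Definition shift_mx j : 'M[F]_j.+1 := \matrix_(a, b) (b == a.+1 :> nat)%:R.

Lemma shift_mx_delta j (a b : 'I_j.+1) : a = b.+1 :> nat ->
  shift_mx j *m delta_mx a 0 = delta_mx b 0 :> 'cV_j.+1.
Proof.
move=> ab; rewrite -colE; apply/matrixP => c d; rewrite !mxE ord1 eqxx andbT.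
by rewrite ab eqSS eq_sym.
Qed.

Lemma shift_mx_delta0 j : shift_mx j *m delta_mx 0 0 = 0 :> 'cV_j.+1.
Proof. by rewrite -colE; apply/matrixP => c d; rewrite !mxE. Qed.

Lemma shift_mxX_delta j s (a b : 'I_j.+1) : a = (b + s)%N :> nat ->
  shift_mx j ^+ s *m delta_mx a 0 = delta_mx b 0 :> 'cV_j.+1.
Proof.
elim: s => [|s IHs] in a b * => [|ab].
  by rewrite addn0 expr0 mul1mx => /val_inj->.
have lt_b : (b.+1 < j.+1)%N.
  by rewrite (leq_ltn_trans _ (ltn_ord a)) // ab addnS ltnS leq_addr.
rewrite exprS -mulmxE -mulmxA (IHs a (Ordinal lt_b)) ?ab /= ?addSnnS //.
exact: shift_mx_delta.
Qed.

Lemma shift_mxX_delta0 j s (a : 'I_j.+1) : (a < s)%N ->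
  shift_mx j ^+ s *m delta_mx a 0 = 0 :> 'cV_j.+1.
Proof.
move=> lt_as; rewrite -(subnKC lt_as) addSnnS addnC exprD -mulmxE -mulmxA.
rewrite (shift_mxX_delta _ _ _ 0) // exprSr -mulmxE -mulmxA shift_mx_delta0.
by rewrite mulmx0.
Qed.

Lemma matrix_delta_eq m n (A B : 'M[F]_(m, n)) :
  (forall j, A *m delta_mx j 0 = B *m delta_mx j 0 :> 'cV_m) -> A = B.
Proof.
move=> AB; apply/matrixP => a b.
by have := congr1 (fun M : 'cV_m => M a 0) (AB b); rewrite -!colE !mxE.
Qed.

Lemma shift_mx_nil j k : (j < k)%N -> shift_mx j ^+ k = 0.
Proof.
move=> jk; apply: matrix_delta_eq => a; rewrite mul0mx shift_mxX_delta0 //.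
exact: leq_trans (ltn_ord a) jk.
Qed.

Lemma row_shift_mx j n (P : 'M[F]_(j.+1, n)) (a : 'I_j.+1) :
  row a (shift_mx j *m P) = if (a < j)%N then row (inord a.+1) P else 0.
Proof.
rewrite row_mul mulmx_sum_row; case: ifP => aj.
  rewrite (bigD1 (inord a.+1)) //= big1 => [|b].
    by rewrite !mxE inordK // eqxx scale1r addr0.
  by rewrite -val_eqE /= !mxE inordK // => /negbTE->; rewrite scale0r.
rewrite big1 // => b _; rewrite !mxE; case: eqP => [ba|]; last by rewrite scale0r.
by have := ltn_ord b; rewrite ba ltnS aj.
Qed.

(** * Krylov matrices and fibres over a chain of vectors *)

Definition krylov_mx j n (B : 'M[F]_n) (v : 'rV[F]_n) : 'M[F]_(j.+1, n) :=
  \matrix_a (v *m B ^+ a).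

Lemma krylov_mx_shift j n (B : 'M[F]_n) (v : 'rV[F]_n) : v *m B ^+ j.+1 = 0 ->
  krylov_mx j n B v *m B = shift_mx j *m krylov_mx j n B v.
Proof.
move=> vB0; apply/row_matrixP => a; rewrite row_shift_mx row_mul !rowK.
rewrite -mulmxA mulmxE -exprSr; case: ifP => [aj|]; first by rewrite inordK.
move/negbT; rewrite -leqNgt -ltnS => ja; rewrite (_ : a.+1 = j.+1) //.
by apply/eqP; rewrite eqn_leq ja ltn_ord.
Qed.

Lemma krylov_mx_free j n (B : 'M[F]_n) (v : 'rV[F]_n) :
  v *m B ^+ j.+1 = 0 -> v *m B ^+ j != 0 -> row_free (krylov_mx j n B v).
Proof.
move=> vB0 vBj; apply: inj_row_free => u uK0; apply/eqP/negPn/negP => /rV0Pn[l0 ul0].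
(* Take the least [l] with [u 0 l != 0] and multiply by [B ^+ (j - l)]: later terms die because
   [v *m B ^+ j.+1 = 0], and only a multiple of [v *m B ^+ j] is left. *)
have [l ul minl] := @arg_minnP _ l0 (fun l => u 0 l != 0) val ul0.
have lj : (l <= j)%N by rewrite -ltnS.
have := congr1 (fun M => M *m B ^+ (j - l)) uK0.
rewrite mul0mx (mulmx_sum_row u) mulmx_suml (bigD1 l) //= big1 ?addr0 => [|b bl].
  rewrite rowK -scalemxAl -mulmxA mulmxE -exprD subnKC // => /eqP.
  by rewrite scaler_eq0 (negbTE ul) (negbTE vBj).
rewrite rowK -scalemxAl -mulmxA mulmxE -exprD.
have [lt_lb|lt_bl|eq_lb] := ltngtP l b.
- rewrite (_ : b + (j - l) = j.+1 + (b - l.+1))%N; last first.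
    by rewrite addnBA // [in RHS]addnBA // addSn subSS addnC.
  by rewrite exprD -mulmxE mulmxA vB0 mul0mx scaler0.
- have [->|/minl] := eqVneq (u 0 b) 0; first by rewrite scale0r.
  by rewrite leqNgt lt_bl.
- by rewrite -val_eqE /= eq_lb eqxx in bl.
Qed.

(** Read row by row, the relation says that each row of [P] is the previous one times [B] and that
    [B] kills the last one, so row 0 determines [P]. *)
Lemma krylov_mxP j n (B : 'M[F]_n) (P : 'M[F]_(j.+1, n)) :
  P *m B = shift_mx j *m P ->
  krylov_mx j n B (row 0 P) = P /\ row 0 P *m B ^+ j.+1 = 0.
Proof.
move=> PB; have rowP (a : 'I_j.+1) : row 0 P *m B ^+ a = row a P.
  case: a => a; elim: a => [|a IHa] lt_aj /=.
    by rewrite expr0 mulmx1; congr row; apply: val_inj.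
  have lt_aj' := ltnW lt_aj.
  rewrite exprSr -mulmxE mulmxA (IHa lt_aj') -row_mul PB row_shift_mx /=.
  by rewrite -ltnS lt_aj; congr row; apply: val_inj; rewrite /= inordK.
split; first by apply/row_matrixP => a; rewrite rowK rowP.
rewrite exprSr -mulmxE mulmxA (rowP ord_max) -row_mul PB row_shift_mx.
by rewrite ltnn.
Qed.

Definition shift_fibre k n j (P : 'M[F]_(j.+1, n)) : nat :=
  #|[set B : 'M[F]_n | (B ^+ k == 0) && (P *m B == shift_mx j *m P)]|.

(** The pairs gained from [j] to [j.+1] have [v *m B ^+ j != 0]. Replacing [v] by its Krylov matrix,
    and recovering it as row 0, identifies them with pairs [(B, P)], [P] free. *)
Lemma annih_count_fibre k n j :
  annih_count k n j.+1 =
    (annih_count k n j + \sum_(P | row_free P) shift_fibre k n j P)%N.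
Proof.
have -> : (\sum_(P | row_free P) shift_fibre k n j P)%N =
   #|[set x : 'M[F]_n * 'rV[F]_n | [&& x.1 ^+ k == 0, x.2 *m x.1 ^+ j.+1 == 0
        & x.2 *m x.1 ^+ j != 0]]|.
  transitivity #|[set x : 'M[F]_n * 'M[F]_(j.+1, n) | [&& row_free x.2,
     x.1 ^+ k == 0 & x.2 *m x.1 == shift_mx j *m x.2]]|.
    rewrite (card_set_pair _ _ (fun (B : 'M[F]_n) (P : 'M[F]_(j.+1, n)) =>
      [&& row_free P,
       B ^+ k == 0 & P *m B == shift_mx j *m P])).
    rewrite big_mkcond; apply: eq_bigr => P _.
    case: (row_free P) => //=.
    by apply/esym/eqP; rewrite cards_eq0; apply/eqP/setP => B; rewrite !inE.
  apply: (card_set_bij _ _ _ _ (fun x => (x.1, row 0 x.2))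
           (fun x => (x.1, krylov_mx j n x.1 x.2))) => [[B P]|[B v]] /=.
    move=> /and3P[fP -> /eqP PB]; have [krP ->] := krylov_mxP _ _ _ _ PB.
    rewrite krP eqxx; split => //=.
    rewrite -[j]/(val (@ord_max j)) -(rowK (fun a : 'I_j.+1 => row 0 P *m B ^+ a)).
    rewrite -[\matrix_a _]/(krylov_mx j n B (row 0 P)) krP.
    apply: contraTneq fP => rP0; apply/row_freePn; exists ord_max.
    by rewrite rP0 sub0mx.
  move=> /and3P[-> /eqP vBS vBj]; rewrite krylov_mx_free // krylov_mx_shift // eqxx.
  by split => //; rewrite rowK expr0 mulmx1.
rewrite /annih_count -[LHS](cardsID [set x : 'M[F]_n * 'rV[F]_n | x.2 *m x.1 ^+ j == 0]).
congr addn; apply: eq_card => -[B v]; rewrite !inE /=.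
  rewrite -andbA; congr andb; apply: andb_idl => /eqP vB.
  by rewrite exprSr -mulmxE mulmxA vB mul0mx.
by rewrite andbC -andbA.
Qed.

(** * Conjugation to a standard chain *)

(** Gaussian elimination gives [col_ebase P *m row_mx 1%:M 0 *m row_ebase P]; the left factor moves
    to the right as a diagonal block. *)
Lemma row_free_pid i m (P : 'M[F]_(i, i + m)) : row_free P ->
  exists2 g : 'M[F]_(i + m), g \in unitmx & P = row_mx 1%:M 0 *m g.
Proof.
move=> /eqP rkP; exists (block_mx (col_ebase P) 0 0 1%:M *m row_ebase P).
  by rewrite unitmx_mul row_ebase_unit block_diag_mx_unit col_ebase_unit unitmx1.
rewrite -[LHS]mulmx_ebase rkP pid_mx_row mulmxA mul_row_block mul_mx_row.
by rewrite !(mul1mx, mulmx1, mul0mx, mulmx0, addr0).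
Qed.

Lemma exprVmx n (g B : 'M[F]_n) k : g \in unitmx ->
  (g *m B *m invmx g) ^+ k = g *m B ^+ k *m invmx g.
Proof.
move=> gU; elim: k => [|k IHk]; first by rewrite !expr0 mulmx1 mulmxV.
by rewrite !exprSr IHk -!mulmxE !mulmxA mulmxKV.
Qed.

Lemma card_fibre_conj k j n (P : 'M[F]_(j.+1, n)) (g : 'M[F]_n) :
  g \in unitmx ->
  shift_fibre k n j (P *m g) = shift_fibre k n j P.
Proof.
move=> gU; apply: (card_set_bij _ _ _ _ (fun B => g *m B *m invmx g)
                     (fun B => invmx g *m B *m g)) => B /andP[/eqP Bk /eqP PB].
  split; last by rewrite !mulmxA mulVmx // mul1mx -mulmxA mulVmx // mulmx1.
  by rewrite exprVmx // Bk mulmx0 mul0mx !mulmxA PB -!mulmxA mulmxV // mulmx1 !eqxx.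
split; last by rewrite !mulmxA mulmxV // mul1mx -mulmxA mulmxV // mulmx1.
have := exprVmx _ (invmx g) B k; rewrite unitmx_inv invmxK => -> //.
by rewrite Bk mulmx0 mul0mx !mulmxA mulmxK // PB !eqxx.
Qed.

(** * Nilpotent block lower triangular matrices *)

Lemma exp_block_lower m j (J : 'M[F]_j) (X : 'M[F]_(m, j)) (C : 'M[F]_m) k :
  block_mx J 0 X C ^+ k =
    block_mx (J ^+ k) 0 (\sum_(s < k) C ^+ (k - s.+1) *m X *m J ^+ s) (C ^+ k).
Proof.
elim: k => [|k IHk]; first by rewrite big_ord0 -scalar_mx_block.
rewrite exprS IHk -mulmxE mulmx_block !mul0mx !mulmx0 !addr0 add0r !mulmxE -!exprS.
congr block_mx; rewrite big_ord_recr /= subnn expr0 mul1mx addrC; congr (_ + _).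
rewrite mulmx_sumr; apply: eq_bigr => s _.
by rewrite !mulmxA mulmxE -exprS -subSn.
Qed.

(** For [j < k], [C ^+ (k - j.+1)] times this vector is the last column of the lower left block of
    [block_mx (shift_mx j) 0 X C ^+ k]. *)
Definition cyc_sum m j (X : 'M[F]_(m, j.+1)) (C : 'M[F]_m) : 'cV[F]_m :=
  \sum_(d < j.+1) C ^+ d *m col d X.

Lemma lower_block_last m j k (X : 'M[F]_(m, j.+1)) (C : 'M[F]_m) : (j < k)%N ->
  (\sum_(s < k) C ^+ (k - s.+1) *m X *m shift_mx j ^+ s) *m delta_mx ord_max 0
    = C ^+ (k - j.+1) *m cyc_sum m j X C.
Proof.
move=> jk; rewrite mulmx_suml (bigID (fun s : 'I_k => s < j.+1)%N) /=.
rewrite [X in _ + X]big1 ?addr0 => [|s]; last first.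
  by rewrite -leqNgt => js; rewrite -mulmxA shift_mxX_delta0 ?mulmx0.
rewrite -(big_ord_widen k (fun s => C ^+ (k - s.+1) *m X *m shift_mx j ^+ s *m
  (delta_mx ord_max 0 : 'cV_j.+1))) //.
(* The power [shift_mx j ^+ s] moves the last basis vector to position [j - s], hence the reversed
   index. *)
rewrite /cyc_sum mulmx_sumr [RHS](reindex_inj rev_ord_inj); apply: eq_bigr => s _.
rewrite -mulmxA (shift_mxX_delta _ _ _ (rev_ord s)) /=; last first.
  by rewrite subSS subnK // -ltnS.
rewrite -mulmxA -colE mulmxA mulmxE -exprD; congr (_ ^+ _ *m _).
by rewrite addnBA ?ltn_ord // subnK.
Qed.

Lemma lower_block_nil m j k (X : 'M[F]_(m, j.+1)) (C : 'M[F]_m) : (j < k)%N ->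
  (block_mx (shift_mx j) 0 X C ^+ k == 0) =
    (C ^+ k == 0) && (C ^+ (k - j.+1) *m cyc_sum m j X C == 0).
Proof.
move=> jk; rewrite -lower_block_last // exp_block_lower shift_mx_nil //.
set Y := \sum_(s < k) _; apply/eqP/andP => [|[/eqP Ck /eqP Yj]].
  rewrite -[X in _ = X -> _](block_mx0 _ j.+1 m j.+1 m).
  by move=> /eq_block_mx[_ _ -> ->]; rewrite mul0mx.
(* A power of a matrix commutes with it, so [Y J = C Y], and [J] shifts the
   vanishing of the last column of [Y] to the other columns. *)
have YJ : Y *m shift_mx j = C *m Y.
  have : block_mx (shift_mx j) 0 X C ^+ k *m block_mx (shift_mx j) 0 X C =
         block_mx (shift_mx j) 0 X C *m block_mx (shift_mx j) 0 X C ^+ k.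
    by rewrite !mulmxE -exprS -exprSr.
  rewrite exp_block_lower shift_mx_nil // Ck !mulmx_block => /eq_block_mx[_ _].
  by rewrite !mulmx0 !mul0mx addr0 add0r.
suff -> : Y = 0 by rewrite Ck block_mx0.
apply: matrix_delta_eq => a; rewrite mul0mx.
have [d] := ubnP (j - a)%N; elim: d => // d IHd in a *; rewrite ltnS => ja.
have [ltaj|] := ltnP a j.
  rewrite -(shift_mx_delta _ (inord a.+1) a) ?inordK // mulmxA YJ -mulmxA.
  by rewrite IHd ?mulmx0 // inordK // subnSK.
move=> leja; rewrite (_ : a = ord_max) //; apply: val_inj; apply/eqP.
by rewrite eqn_leq leja -ltnS ltn_ord.
Qed.

(** Column 0 of [X] enters [cyc_sum] with coefficient 1. Translating it by the contribution of the
    other columns leaves a condition on column 0 alone, and the other [m * j] entries are free. *)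
Lemma card_cyc_sum m j c (C : 'M[F]_m) :
  #|[set X : 'M[F]_(m, j.+1) | C ^+ c *m cyc_sum m j X C == 0]| =
    (#|F| ^ (m * j) * #|[set y : 'cV[F]_m | C ^+ c *m y == 0%R]|)%N.
Proof.
pose h X0 := cyc_sum m j (row_mx (0 : 'cV_m) X0) C.
have cycE (y : 'cV_m) X0 : cyc_sum m j (row_mx y X0) C = y + h X0.
  rewrite /h /cyc_sum !big_ord_recl !expr0 !mul1mx.
  have col0 (z : 'cV_m) : col 0 (row_mx z X0 : 'M_(m, 1 + j)) = z.
    by apply/matrixP => a b; rewrite (ord1 b) !mxE; case: splitP => // c0 _; rewrite ord1.
  rewrite !col0 add0r; congr (_ + _); apply: eq_bigr => d _; congr (_ *m _).
  by apply/matrixP => a b; rewrite !mxE; case: splitP => // c0; rewrite ord1.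
transitivity #|[set x : 'cV[F]_m * 'M[F]_(m, j) | C ^+ c *m (x.1 + h x.2) == 0]|.
  apply: (card_set_bij _ _ _ _ (fun X : 'M_(m, 1 + j) => (lsubmx X, rsubmx X))
    (fun x => row_mx x.1 x.2)) => [X|[y X]] /=.
    by rewrite -cycE hsubmxK.
  by rewrite -cycE row_mxKl row_mxKr.
rewrite (card_set_pair _ _ (fun y X => C ^+ c *m (y + h X) == 0)).
rewrite -card_mx -sum_nat_const; apply: eq_bigr => X _.
by apply: (card_set_bij _ _ _ _ (fun y => y + h X) (fun y => y - h X)) => y;
   rewrite ?addrK ?subrK.
Qed.

(** The fibres lead to kernels on columns, while [annih_count] uses rows; transposition exchanges
    the two. *)
Lemma annih_count_tr k m c :
  annih_count k m c =
    (\sum_(C : 'M[F]_m | C ^+ k == 0%R) #|[set y : 'cV[F]_m | C ^+ c *m y == 0%R]|)%N.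
Proof.
have trX (B : 'M[F]_m) i : B^T ^+ i = (B ^+ i)^T.
  elim: i => [|i IHi]; first by rewrite !expr0 trmx1.
  by rewrite exprS exprSr IHi -!mulmxE trmx_mul.
transitivity #|[set x : 'cV[F]_m * 'M[F]_m |
                 (x.2 ^+ k == 0) && (x.2 ^+ c *m x.1 == 0)]|.
  apply: (card_set_bij _ _ _ _ (fun x => (x.2^T, x.1^T)) (fun x => (x.2^T, x.1^T))).
    by move=> [B v] /=; rewrite !trX -trmx_mul !trmxK => /andP[/eqP-> /eqP->];
      rewrite !trmx0 !eqxx.
  by move=> [y C] /=; rewrite !trX -trmx_mul !trmxK => /andP[/eqP-> /eqP->];
      rewrite !trmx0 !eqxx.
rewrite (card_set_pair _ _ (fun (y : 'cV[F]_m) (C : 'M[F]_m) =>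
  (C ^+ k == 0) && (C ^+ c *m y == 0))).
rewrite [RHS]big_mkcond; apply: eq_bigr => C _; case: (C ^+ k == 0) => //=.
by apply/eqP; rewrite cards_eq0; apply/eqP/setP => y; rewrite !inE.
Qed.

(** Here the relation fixes the top block row of [B] as [row_mx (shift_mx j) 0], leaving the lower
    blocks [X] and [C] subject to [lower_block_nil]. *)
Lemma shift_fibre_id k m j : (j < k)%N ->
  shift_fibre k (j.+1 + m) j (row_mx 1%:M 0) =
    (#|F| ^ (m * j) * annih_count k m (k - j.+1))%N.
Proof.
move=> jk; rewrite annih_count_tr big_distrr /=.
transitivity #|[set x : 'M[F]_(m, j.+1) * 'M[F]_m | (x.2 ^+ k == 0) &&
                   (x.2 ^+ (k - j.+1) *m cyc_sum m j x.1 x.2 == 0)]|.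
  apply: (card_set_bij _ _ _ _ (fun B => (dlsubmx B, drsubmx B))
    (fun x => block_mx (shift_mx j) 0 x.1 x.2)) => [B|[X C]] /=.
    rewrite -lower_block_nil // => /andP[Bk]; rewrite -[in X in X -> _](submxK B).
    rewrite mul_row_block mul_mx_row !mul1mx !mul0mx !addr0 mulmx1 mulmx0.
    move/eqP/eq_row_mx => [<- <-]; by rewrite submxK.
  rewrite -lower_block_nil // block_mxKdl block_mxKdr => ->; split => //=.
  by rewrite mul_row_block mul_mx_row !mul1mx !mul0mx !addr0 mulmx1 mulmx0.
rewrite (card_set_pair _ _ (fun (X : 'M[F]_(m, j.+1)) (C : 'M[F]_m) =>
  (C ^+ k == 0) &&
  (C ^+ (k - j.+1) *m cyc_sum m j X C == 0))).
rewrite [RHS]big_mkcond; apply: eq_bigr => C _; rewrite -card_cyc_sum.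
case: (C ^+ k == 0) => //=.
by apply/eqP; rewrite cards_eq0; apply/eqP/setP => y; rewrite !inE.
Qed.

(** * The recursion and the explicit count of free matrices *)

(** Every free [P] is [row_mx 1%:M 0 *m g] with [g] invertible, and conjugation by [g] makes all
    fibres equally large. *)
Lemma annih_countS k n j : (j < k)%N ->
  annih_count k n j.+1 = (annih_count k n j +
    free_count j.+1 n *
      (#|F| ^ ((n - j.+1) * j) * annih_count k (n - j.+1) (k - j.+1)))%N.
Proof.
move=> jk; rewrite annih_count_fibre; congr addn.
rewrite /free_count -sum1dep_card big_distrl /=; apply: eq_bigr => P fP.
(* A free [P] exists only if [j < n], so the truncated [n - j.+1] is a true difference here. *)
have jn : (j.+1 <= n)%N by rewrite -(eqP fP) rank_leq_col.
rewrite mul1n; set m := (n - j.+1)%N.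
have n_def : n = (j.+1 + m)%N by rewrite subnKC.
clearbody m; subst n; have [g gU ->] := row_free_pid _ _ _ fP.
by rewrite card_fibre_conj // shift_fibre_id.
Qed.

Lemma free_count_prod i n : (i <= n)%N ->
  free_count i n =
    (#|F| ^ 'C(i, 2) * \prod_(l < i) (#|F| ^ (n - l) - 1))%N.
Proof.
elim: i => [|i IHi] lt_in; first by rewrite free_count0 big_ord0.
rewrite free_countS IHi ?(ltnW lt_in) // big_ord_recr /= binS bin1 expnD.
have -> : (#|F| ^ n - #|F| ^ i = #|F| ^ i * (#|F| ^ (n - i) - 1))%N.
  by rewrite mulnBr muln1 -expnD subnKC // ltnW.
by rewrite mulnACA.
Qed.

Lemma free_count_eq0 i n : (n < i)%N -> free_count i n = 0%N.
Proof.
move=> lt_ni; apply/eqP; rewrite cards_eq0; apply/eqP/setP => P; rewrite !inE.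
by rewrite -row_leq_rank leqNgt (leq_ltn_trans (rank_leq_col P)).
Qed.

End Counting.

(** * Divisibility form of fractional valuation bounds *)

Section Valuation.

Variables (p K : nat).
Hypotheses (p_prime : prime p) (K_gt0 : (0 < K)%N).

(* The bound [M <= K * v_p(a)], in a form which also makes sense for [a = 0]
   and is obviously stable under sums and differences. *)
Definition val_ge (M a : nat) : Prop :=
  forall t, (t * K < M + K)%N -> (p ^ t %| a)%N.

Lemma val_ge_logn M a : (0 < a)%N -> val_ge M a <-> (M <= K * logn p a)%N.
Proof.
move=> a_gt0; split => [Ma|le_M t].
  rewrite leqNgt; apply/negP => lt_M; have := Ma (logn p a).+1.
  by rewrite mulSn addnC ltn_add2r mulnC lt_M pfactor_dvdn // ltnn => /(_ isT).
move=> lt_t; rewrite pfactor_dvdn // -ltnS -(ltn_pmul2r K_gt0).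
by rewrite (leq_trans lt_t) // mulSn addnC leq_add2l mulnC.
Qed.

Lemma val_ge_leq M N a : (M <= N)%N -> val_ge N a -> val_ge M a.
Proof.
by move=> le_MN Na t lt_t; apply: Na; rewrite (leq_trans lt_t) ?leq_add2r.
Qed.

Lemma val_ge_dvd M a b : (a %| b)%N -> val_ge M a -> val_ge M b.
Proof. by move=> ab Ma t /Ma /dvdn_trans; apply. Qed.

Lemma val_ge_addr M a b : val_ge M b -> val_ge M (a + b) <-> val_ge M a.
Proof.
by move=> Mb; split=> Ma t lt_t; have := Ma t lt_t; rewrite dvdn_addl ?Mb.
Qed.

Lemma val_ge_sum M m n (D : nat -> nat) :
  (forall j, (m <= j < n)%N -> val_ge M (D j)) ->
  val_ge M (\sum_(m <= j < n) D j).
Proof.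
move=> MD t lt_t; rewrite big_nat; apply: dvdn_sum => j mjn; exact: MD.
Qed.

Lemma val_ge_coprime M u a : coprime p u -> val_ge M (u * a) <-> val_ge M a.
Proof.
move=> pu; split=> Ma t lt_t; last exact/dvdn_mull/Ma.
by have := Ma t lt_t; rewrite Gauss_dvdr // coprimeXl.
Qed.

Lemma val_ge_exp M s a : val_ge (M + s * K) (p ^ s * a) <-> val_ge M a.
Proof.
have ps_gt0 : (0 < p ^ s)%N by rewrite expn_gt0 prime_gt0.
split=> Ma t lt_t.
  have := Ma (s + t)%N; rewrite expnD dvdn_pmul2l //; apply.
  by rewrite mulnDl addnC addnAC ltn_add2r.
have [le_ts|/ltnW le_st] := leqP t s; first exact/dvdn_mulr/dvdn_exp2l.
rewrite -(subnKC le_st) expnD dvdn_pmul2l //; apply: Ma.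
by rewrite mulnBl ltn_subLR ?leq_mul2r ?le_st ?orbT // addnA [(_ + M)%N]addnC.
Qed.

End Valuation.

(** * Valuations along the recursion *)

Section Bounds.

Variables (p e k : nat) (F : finFieldType).
Hypotheses (p_prime : prime p) (e_gt0 : (0 < e)%N) (k_gt0 : (0 < k)%N).
Hypothesis card_F : #|F| = (p ^ e)%N.

Let c := annih_count F k.

Let step n j : nat :=
  (free_count F j.+1 n * (#|F| ^ ((n - j.+1) * j) * c (n - j.+1) (k - j.+1)))%N.

(* [weight n i / k.+1] is the bound for [v_q (c n i)], [i < k]. *)
Definition weight (n i : nat) : nat := (k.-1 * 'C(n, 2) + i * n)%N.

Local Notation vge := (val_ge p k.+1).

Lemma annih_count_sum n i l : (i <= l <= k)%N ->
  c n l = (c n i + \sum_(i <= j < l) step n j)%N.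
Proof.
elim: l => [|l IHl]; first by rewrite leqn0 andbT => /eqP->; rewrite big_geq ?addn0.
rewrite leq_eqVlt => /andP[/predU1P[<-|le_il] lt_lk].
  by rewrite big_geq ?addn0.
rewrite big_nat_recr //= addnA -IHl; first exact: annih_countS.
by rewrite -ltnS le_il ltnW.
Qed.

Lemma coprime_expB1 n : (0 < n)%N -> coprime p (#|F| ^ n - 1).
Proof.
move=> n_gt0; apply: coprime_dvdl (_ : p %| #|F| ^ n)%N _.
  by rewrite card_F -expnM dvdn_exp // muln_gt0 e_gt0.
by rewrite subn1 coprime_sym coprimePn // expn_gt0 card_F expn_gt0 prime_gt0.
Qed.

(** This identity dictates the choice of [weight]: the power of [#|F|] in [step] makes up exactly
    the gap between the weights at [n, j] and at [n - j.+1, k - j.+1]. *)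
Lemma weightE m j : (j < k)%N ->
  weight (j.+1 + m) j =
    (weight m (k - j.+1) + ('C(j.+1, 2) + m * j) * k.+1)%N.
Proof.
move=> jk; rewrite /weight.
have binD : 'C(j.+1 + m, 2) = ('C(j.+1, 2) + 'C(m, 2) + j.+1 * m)%N.
  elim: m => [|m IHm]; first by rewrite addn0 muln0 bin0n !addn0.
  by rewrite addnS binS bin1 IHm (binS m) bin1; lia.
have bin_j : ('C(j.+1, 2) * 2 = j.+1 * j)%N by rewrite mulnC -mul_bin_diag bin1.
rewrite binD; move: ('C(j.+1, 2)) ('C(m, 2)) bin_j => a b bin_j.
rewrite -(subnKC jk) /= addKn; move: (k - j.+1)%N => r; nia.
Qed.

(** The factors [#|F| ^ (n - l) - 1] are prime to [p], so only the power of [#|F|] shifts the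
    valuation. The slack [x] serves both the bound ([x = 0]) and a strict excess ([x = 1]). *)
Lemma step_val n j x : (j < k)%N -> (j < n)%N ->
  vge (e * weight n j + x) (step n j) <->
  vge (e * weight (n - j.+1) (k - j.+1) + x) (c (n - j.+1) (k - j.+1)).
Proof.
move=> jk jn; rewrite /step free_count_prod // -{1}(subnKC jn) weightE //.
set m := (n - j.+1)%N.
rewrite [X in vge _ X](_ : _ = (\prod_(l < j.+1) (#|F| ^ (n - l) - 1) *
   (p ^ (e * ('C(j.+1, 2) + m * j)) * c m (k - j.+1)))%N); last first.
  by rewrite (expnM p) -card_F expnD; lia.
rewrite val_ge_coprime; last first.
  apply: (big_ind (fun u => coprime p u)) => [|u v pu pv|l _].
  - by rewrite coprimen1.
  - by rewrite coprimeMr pu.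
  - by rewrite coprime_expB1 // subn_gt0 (leq_trans (ltn_ord l)).
rewrite mulnDr addnAC mulnA; exact: val_ge_exp.
Qed.

Lemma step_ge n j : (j < k)%N ->
  ((j < n)%N ->
     vge (e * weight (n - j.+1) (k - j.+1)) (c (n - j.+1) (k - j.+1))) ->
  vge (e * weight n j) (step n j).
Proof.
move=> jk c_ge; have [jn|nj] := ltnP j n.
  rewrite -[X in vge X]addn0; apply/step_val => //.
  by rewrite addn0; exact: c_ge.
by move=> t _; rewrite /step free_count_eq0 ?mul0n.
Qed.

Lemma annih_count_full_val n x : vge x (c n 0) -> vge (x + e * n * k.+1) (c n k).
Proof.
move=> x0; rewrite /c annih_count_full -annih_count0 card_F -expnM [X in vge _ X]mulnC.
exact/val_ge_exp.
Qed.

(** Telescoping from 0 to [k] compares [c n k = #|F| ^ n * c n 0] with [c n 0]; for [n > 0] the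
    factor on the left is prime to [p]. *)
Lemma annih_count_step_sum n :
  ((#|F| ^ n - 1) * c n 0 = \sum_(0 <= j < k) step n j)%N.
Proof.
have := annih_count_sum n 0 k (leqnn k); rewrite {1}/c annih_count_full.
by rewrite -annih_count0 mulnC mulnBl mul1n => ->; rewrite addKn.
Qed.

Lemma annih_count_val n i : (i < k)%N -> vge (e * weight n i) (c n i).
Proof.
elim/ltn_ind: n i => n IHn i ik; case: (posnP n) => [->|n_gt0].
  move=> t; rewrite /weight bin0n !muln0 add0n -[X in (_ < X)%N]mul1n.
  by rewrite ltn_pmul2r // ltnS leqn0 => /eqP->; rewrite expn0 dvd1n.
have step_n j : (j < k)%N -> vge (e * weight n j) (step n j).
  by move=> jk; apply: step_ge => // jn; apply: IHn; rewrite ltn_subrL ?n_gt0.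
have c0 : vge (e * weight n 0) (c n 0).
  apply/(val_ge_coprime _ _ _ (#|F| ^ n - 1)); first exact: coprime_expB1.
  rewrite annih_count_step_sum; apply: val_ge_sum => j /andP[_ jk].
  apply: val_ge_leq (step_n j jk); by rewrite /weight leq_mul2l leq_add2l orbT.
(* Descend from [c n k] rather than ascend from [c n 0]: the steps [j >= i] have weight at least
   [weight n i], the earlier ones need not. *)
have := annih_count_sum n i k; rewrite leqnn ltnW // => /(_ isT) cE.
have {cE}ck : vge (e * weight n i) (c n i + \sum_(i <= j < k) step n j).
  rewrite -cE; apply: val_ge_leq (annih_count_full_val n _ c0).
  rewrite /weight; nia.
apply/val_ge_addr/ck; apply: val_ge_sum => j /andP[ij jk].
by apply: val_ge_leq (step_n j jk); rewrite leq_mul2l leq_add2l leq_mul2r ij !orbT.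
Qed.

(* Only the step [j = 0] at [n], followed by [j = k.-1] at [n.-1], can reach the
   minimal valuation. *)
Lemma annih_count_exact n : (k < n)%N ->
  vge (e * weight n 0 + 1) (c n 0) ->
  vge (e * weight (n - k.+1) 0 + 1) (c (n - k.+1) 0).
Proof.
move=> kn c0; have n_gt0 : (0 < n)%N by apply: leq_ltn_trans kn.
(* An excess in [c n 0] passes to [step n 0], since the steps [j > 0] have weight larger by [j * n];
   [step_val] then carries it to [c n.-1 k.-1]. *)
have c1 : vge (e * weight n.-1 k.-1 + 1) (c n.-1 k.-1).
  rewrite -!subn1; apply/step_val => //.
  have : vge (e * weight n 0 + 1) ((#|F| ^ n - 1) * c n 0).
    exact: val_ge_dvd (dvdn_mull _ (dvdnn _)) c0.
  rewrite annih_count_step_sum big_ltn // => /val_ge_addr; apply.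
  apply: val_ge_sum => j /andP[j_gt0 jk].
  apply: val_ge_leq (step_ge n j jk _) => [|jn]; last first.
    by apply: annih_count_val; rewrite ltn_subrL.
  rewrite /weight; nia.
have := annih_count_sum n.-1 k.-1 k; rewrite leqnn leq_pred => /(_ isT).
rewrite -{4}(prednK k_gt0) big_nat1 => cE.
(* The bound for [c n.-1 k] exceeds [e * weight n.-1 k.-1] by [2 * e * n.-1], positive since
   [n > k > 0]. *)
have : vge (e * weight n.-1 k.-1 + 1) (c n.-1 k).
  have c0' := annih_count_val n.-1 0 k_gt0.
  apply: val_ge_leq (annih_count_full_val _ _ c0'); rewrite /weight; nia.
have lt_k : (k.-1 < k)%N by rewrite ltn_predL.
have lt_n : (k.-1 < n.-1)%N by rewrite -ltnS !prednK.
rewrite cE [(c _ _ + _)%N]addnC => /(proj1 (val_ge_addr _ _ _ _ _ c1)).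
move=> /(proj1 (step_val _ _ _ lt_k lt_n)).
by rewrite prednK // subnn -[(n.-1 - k)%N]subSS prednK.
Qed.

(** Descent by [k.+1] ends at [n <= 1], where zero is the only solution and the count 1 has
    valuation 0. *)
Lemma annih_count_exact_mod n : (n = 0 %[mod k.+1])%N \/ (n = 1 %[mod k.+1])%N ->
  ~ vge (e * weight n 0 + 1) (c n 0).
Proof.
elim/ltn_ind: n => n IHn n_mod c0; have [kn|nk] := ltnP k n.
  apply: (IHn (n - k.+1)%N); last exact: annih_count_exact.
    by rewrite ltn_subrL (leq_ltn_trans _ kn).
  by rewrite -(subnK kn) !modnDr in n_mod.
rewrite (val_ge_logn _ _ p_prime) // in c0; last first.
  rewrite /c annih_count0 card_gt0; apply/set0Pn; exists 0.
  by rewrite inE expr0n gtn_eqF.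
have n_le1 : (n <= 1)%N by case: n_mod; rewrite !modn_small // => ->.
suff c1 : c n 0 = 1%N by rewrite c1 logn1 muln0 addn1 in c0.
rewrite /c annih_count0 /num_nilp -(cards1 (0 : 'M[F]_n)).
apply: eq_card => B; rewrite !inE; apply/eqP/eqP => [Bk|->]; last first.
  by rewrite expr0n gtn_eqF.
case: n n_le1 {n_mod c0 IHn nk} B Bk => [|[]]// _ B Bk.
  by apply/matrixP => -[].
move: Bk; rewrite (mx11_scalar B) -rmorphXn => /matrixP/(_ 0 0) /eqP.
by rewrite !mxE eqxx mulr1n expf_eq0 k_gt0 => /eqP->; rewrite raddf0.
Qed.

End Bounds.

(** * Back to rational valuations *)

Theorem theorem3p3 (p e : nat) (p_prime : prime p) (e_gt0 : (0 < e)%N)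
    (F : finFieldType) (card_F : #|F| = (p ^ e)%N)
    (n k : nat) (k_gt0 : (0 < k)%N) :
  (k%:R - 1) / (k%:R + 1) * 'C(n, 2)%:R <= vq p e (num_nilp F n k)%:Z /\
  ((n = 0 %[mod k.+1])%N \/ (n = 1 %[mod k.+1])%N ->
   vq p e (num_nilp F n k)%:Z = (k%:R - 1) / (k%:R + 1) * 'C(n, 2)%:R).
Proof.
have a_gt0 : (0 < num_nilp F n k)%N.
  by rewrite card_gt0; apply/set0Pn; exists 0; rewrite inE expr0n gtn_eqF.
rewrite /vq /=; set v := logn p _.
have e_pos : (0 : rat) < e%:R by rewrite ltr0n.
have k1_pos : (0 : rat) < k.+1%:R by rewrite ltr0n.
have -> : k%:R - 1 = k.-1%:R :> rat by rewrite -subn1 natrB.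
rewrite natr1 mulrAC.
have val_c := annih_count_val _ _ _ _ p_prime e_gt0 k_gt0 card_F n 0 k_gt0.
rewrite annih_count0 in val_c.
have le_v : (e * (k.-1 * 'C(n, 2)) <= k.+1 * v)%N.
  by move/val_ge_logn: val_c; rewrite /weight mul0n addn0; apply.
split=> [|n_mod].
  by rewrite ler_pdivrMr // mulrAC ler_pdivlMr // -!natrM ler_nat mulnC (mulnC v).
suff v_eq : (e * (k.-1 * 'C(n, 2)) = k.+1 * v)%N.
  apply: (mulIf (lt0r_neq0 e_pos)); rewrite mulfVK ?lt0r_neq0 //.
  apply: (mulIf (lt0r_neq0 k1_pos)); rewrite [RHS]mulrAC mulfVK ?lt0r_neq0 //.
  by rewrite -!natrM mulnC -v_eq mulnC.
apply/eqP; rewrite eqn_leq le_v /=.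
(* A strict inequality would be the excess excluded by [annih_count_exact_mod]. *)
rewrite leqNgt; apply/negP => lt_v.
apply: (annih_count_exact_mod _ _ _ _ p_prime e_gt0 k_gt0 card_F n n_mod).
rewrite annih_count0; apply/val_ge_logn => //.
by rewrite /weight mul0n addn0 addn1.
Qed.
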